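(* Let $\alpha=\alpha_0^{p^s}\in\mathcal{T}_2\setminus\{0\}$, where $\alpha_0\in\mathcal{T}_2$ is such that $x^n-\alpha_0$ is irreducible over $\mathcal{R}_2$. Let $\mathcal{C}$ be an $\alpha$-constacyclic code of length $np^s$ over $\mathcal{R}_2$. For $0\le\rho\le np^s$, let $\mathcal{A}_\rho$ denote the number of codewords in $\mathcal{C}$ having RT weight $\rho$. (a) If $\mathcal{C}=\{0\}$, then $\mathcal{A}_0=1$ and $\mathcal{A}_\rho=0$ for $1\le\rho\le np^s$. (b) If $\mathcal{C}=\langle1\rangle$, then $\mathcal{A}_0=1$ and $\mathcal{A}_\rho=(p^{2m}-1)p^{2m(\rho-1)}$ for $1\le\rho\le np^s$. (c) If $\mathcal{C}=\langle\gamma(x^n-\alpha_0)^\tau\rangle$ is of Type II, then $$\mathcal{A}_\rho=\begin{cases}1&\text{if }\rho=0;\\0&\text{if }1\le\rho\le n\tau;\\(p^m-1)p^{m(\rho-n\tau-1)}&\text{if }n\tau+1\le\rho\le np^s.\end{cases}$$ (d) If $\mathcal{C}=\langle(x^n-\alpha_0)^\omega+\gamma(x^n-\alpha_0)^tG(x)\rangle$ is of Type III, then $$\mathcal{A}_\rho=\begin{cases}1&\text{if }\rho=0;\\0&\text{if }1\le\rho\le n\kappa;\\(p^m-1)p^{m(\rho-n\kappa-1)}&\text{if }n\kappa+1\le\rho\le n\omega;\\(p^{2m}-1)p^{m(2\rho-n\omega-n\kappa-2)}&\text{if }n\omega+1\le\rho\le np^s.\end{cases}$$ (e) If $\mathcal{C}=\langle(x^n-\alpha_0)^\omega+\gamma(x^n-\alpha_0)^tG(x),\gamma(x^n-\alpha_0)^\mu\rangle$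 is of Type IV, then $$\mathcal{A}_\rho=\begin{cases}1&\text{if }\rho=0;\\0&\text{if }1\le\rho\le n\mu;\\(p^m-1)p^{m(\rho-n\mu-1)}&\text{if }n\mu+1\le\rho\le n\omega;\\(p^{2m}-1)p^{m(2\rho-n\omega-n\mu-2)}&\text{if }n\omega+1\le\rho\le np^s.\end{cases}$$
   Context: $\mathcal{R}_2$ is a finite commutative chain ring with unity, with maximal ideal $\langle\gamma\rangle$, where $\gamma\neq0$ and $\gamma^2=0$; its residue field has order $p^m$, $p$ prime. $\zeta\in\mathcal{R}_2$ has multiplicative order $p^m-1$ and $\mathcal{T}_2=\{0,1,\zeta,\dots,\zeta^{p^m-2}\}$. $n,s$ are positive integers with $\gcd(n,p)=1$. $\alpha$-constacyclic codes of length $np^s$ over $\mathcal{R}_2$ are identified with ideals of $\mathcal{R}_{\alpha,0}=\mathcal{R}_2[x]/\langle x^{np^s}-\alpha\rangle$, whose elements are represented by polynomials of degree less than $np^s$. The Rosenbloom-Tsfasman (RT) weight is $w_{RT}(c(x))=1+\deg c(x)$ if $c(x)\neq0$ and $w_{RT}(0)=0$. Put $f(x)=x^n-\alpha_0$, and let $\mathcal{P}_n(\mathcal{T}_2)$ be the set of polynomials with coefficients in $\mathcal{T}_2$ that are $0$ or of degree less than $n$. The ideals of $\mathcal{R}_{\alpha,0}$ are: Type I: $\{0\}$, $\langle1\rangle$. Type II: $\langle\gamma f^\tau\rangle$, $0\le\tau<p^s$. Type III: $\langle f^\omega+\gamma f^tG\rangle$, where $0<\omega<p^s$, $0\le t<\kappa$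 if $G\neq0$, and $G$ is $0$ or a unit of $\mathcal{R}_{\alpha,0}$ of the form $\sum_{i=0}^{\kappa-t-1}a_i(x)f(x)^i$ with $a_i\in\mathcal{P}_n(\mathcal{T}_2)$. Type IV: $\langle f^\omega+\gamma f^tG,\gamma f^\mu\rangle$, where $0\le\mu<\kappa\le\omega<p^s$, $0\le t<\mu$ if $G\neq0$, and $G$ is $0$ or a unit of $\mathcal{R}_{\alpha,0}$ of the form $\sum_{i=0}^{\mu-t-1}a_i(x)f(x)^i$ with $a_i\in\mathcal{P}_n(\mathcal{T}_2)$. In both types $\kappa$ is the smallest non-negative integer with $\gamma f^\kappa\in\langle f^\omega+\gamma f^tG\rangle$. *)

(* Defs.v *)
From HB Require Import structures.
From mathcomp Require Import all_boot all_order all_algebra.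
Set Implicit Arguments.
Unset Strict Implicit.
Unset Printing Implicit Defensive.
Import GRing.Theory.
Local Open Scope ring_scope.

(* qpoly.v makes {poly %/ h} a finite type when R is finite and a commutative
   ring when R is commutative; this joins the two. *)
HB.instance Definition _ (R : finComNzRingType) (h : {poly R}) :=
  Finite.on {poly %/ h}.

Section Ideals.
Variable A : finComNzRingType.
Implicit Types I J M : {set A}.

Definition is_ideal I : Prop :=
  [/\ 0 \in I,
      forall x y, x \in I -> y \in I -> x + y \in I
    & forall a x, x \in I -> a * x \in I].

Definition ideal1 (g : A) : {set A} := [set a * g | a : A].
Definition ideal2 (g1 g2 : A) : {set A} :=
  [set a * g1 + b * g2 | a : A, b : A].

Definition chain_ring : Prop :=
  forall I J, is_ideal I -> is_ideal J -> I \subset J \/ J \subset I.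

Definition maximal_ideal M : Prop :=
  [/\ is_ideal M, M <> setT
    & forall I, is_ideal I -> M \subset I -> I = M \/ I = setT].

(* The residue ring A / I, as the set of the cosets x + I. *)
Definition cosets I : {set {set A}} := [set [set x + y | y in I] | x : A].

End Ideals.

(* GRing.unit needs a unitRingType, which neither {poly R} nor {poly %/ h} is
   when R is not a domain; irreducible_poly has the same limitation. *)
Definition invertible (A : comNzRingType) (x : A) : Prop :=
  exists y : A, x * y = 1.

Definition irreducible_elt (A : comNzRingType) (x : A) : Prop :=
  [/\ x <> 0, ~ invertible x
    & forall y z : A, x = y * z -> invertible y \/ invertible z].

Section Codes.
Variable R : finComNzRingType.

Definition teichmuller (q : nat) (zeta : R) : {set R} :=
  0 |: [set zeta ^+ (i : 'I_(q - 1)) | i : 'I_(q - 1)].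

Definition polys_lt (n : nat) (T : {set R}) (a : {poly R}) : Prop :=
  (a \is a polyOver T) /\ (size a <= n)%N.

Definition xn_sub (n : nat) (alpha : R) : {poly R} := 'X^n - alpha%:P.

(* Hence {poly %/ xn_sub N alpha} is R[x] / <x^N - alpha>, and the coercion of
   its elements to {poly R} gives the representative of degree < N. *)
Lemma mk_monic_xn_sub N (alpha : R) : (0 < N)%N ->
  mk_monic (xn_sub N alpha) = xn_sub N alpha.
Proof.
by move=> N0; rewrite /mk_monic /xn_sub size_XnsubC // ltnS N0 monicXnsubC.
Qed.

Section Quotient.
Variable h : {poly R}.
Local Notation Q := {poly %/ h}.
Implicit Types (c f g G : Q) (C : {set Q}).

Definition wRT c : nat :=
  if c == 0 then 0%N else (1 + (size (c : {poly R})).-1)%N.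

Definition num_weight C (rho : nat) : nat := #|[set c in C | wRT c == rho]|.

(* In what follows f, g stand for x^n - alpha_0 and gamma, and q for p^s. *)

Definition adic_form n (T : {set R}) f (d : nat) G : Prop :=
  exists a : nat -> {poly R},
    (forall i, (i < d)%N -> polys_lt n T (a i)) /\
    G = \sum_(i < d) in_qpoly h (a i) * f ^+ i.

Definition main_gen f g (omega t : nat) G : Q := f ^+ omega + g * f ^+ t * G.

Definition is_kappa f g omega t G (kappa : nat) : Prop :=
  g * f ^+ kappa \in ideal1 (main_gen f g omega t G) /\
  forall j, g * f ^+ j \in ideal1 (main_gen f g omega t G) -> (kappa <= j)%N.

Definition typeII q f g (tau : nat) C : Prop :=
  (tau < q)%N /\ C = ideal1 (g * f ^+ tau).

Definition typeIII n (T : {set R}) q f g omega t G kappa C : Prop :=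
  [/\ (0 < omega < q)%N,
      is_kappa f g omega t G kappa,
      G <> 0 -> (t < kappa)%N,
      G = 0 \/ (invertible G /\ adic_form n T f (kappa - t) G)
    & C = ideal1 (main_gen f g omega t G)].

Definition typeIV n (T : {set R}) q f g omega t G kappa mu C : Prop :=
  [/\ (mu < kappa <= omega)%N && (omega < q)%N,
      is_kappa f g omega t G kappa,
      G <> 0 -> (t < mu)%N,
      G = 0 \/ (invertible G /\ adic_form n T f (mu - t) G)
    & C = ideal2 (main_gen f g omega t G) (g * f ^+ mu)].

End Quotient.
End Codes.

(* Main.v *)
Require Import Defs.
From HB Require Import structures.
From mathcomp Require Import all_boot all_order all_algebra.
From mathcomp Require Import separable ring zify.
Set Implicit Arguments.
Unset Strict Implicit.
Unset Printing Implicit Defensive.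
Import GRing.Theory.
Local Open Scope ring_scope.

(** Let q be the order of the residue field K of R; the kernel gamma R of the
    reduction R -> K also has order q, so |R| = q ^ 2. Write f for x ^ n - alpha0,
    P for p ^ s, h = x ^ (n P) - alpha, and fbar for the reduction of f. Two facts
    on K hold up the whole argument: hbar = fbar ^ P, because K has characteristic
    p; and fbar is irreducible, because fbar is separable, so that a proper
    factorisation over K would lift to one over R ([irreducible_red]).

    An ideal C of R[x] / h has a residue, the image of C in K[x] / fbar ^ P, and a
    torsion, the ideal of the reductions of all p with gamma p in C. If they are
    generated by fbar ^ w and fbar ^ k, with k <= w, then the pair (w, k) determines
    the weight distribution. The leading coefficients of the codewords of
    degree exactly r, with 0 added, form 0 for r < n k, gamma R for
    n k <= r < n w, and R from n w on. Indeed a codeword of degree less than n w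
    reduces to 0, hence is gamma times an element of the torsion; conversely C
    contains gamma f ^ k and, once the gamma-part has been reduced modulo f ^ k, a
    monic polynomial of degree n w. The codewords of degree at most r thus number
    1, q or q ^ 2 times those of degree less than r, and
    [num_weight_residue_torsion] follows, since the RT weight is the number of
    coefficients up to the leading one.

    It remains to read off (w, k) for each type: (P, P) for 0, (0, 0) for the whole
    ring, (P, tau) for Type II, (omega, kappa) for Type III and (omega, mu) for
    Type IV. In Type III the torsion is generated by some fbar ^ j since fbar is
    irreducible, and minimality of kappa says j = kappa ([torsion_minimal]);
    moreover kappa <= omega as gamma (f ^ omega + gamma e) = gamma f ^ omega. In
    Type IV the extra generator gamma f ^ mu enlarges the torsion to the ideal of
    fbar ^ mu. *)

(** * Chain rings of nilpotency index two and their residue field *)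

Lemma card_fibred (A : finZmodType) (B : finType) (f : A -> B) (S H : {set A}) :
  {in S, forall x y, (y \in S) && (f y == f x) = (y - x \in H)} ->
  #|S| = (#|f @: S| * #|H|)%N.
Proof.
move=> fibre; rewrite -sum1_card (partition_big_imset f) /= -sum_nat_const.
apply: eq_bigr => _ /imsetP[x Sx ->]; rewrite sum1_card.
rewrite -(card_preimset H (addIr (- x))); apply: eq_card => y.
by rewrite !inE /= -topredE /= fibre.
Qed.

Lemma is_ideal_ideal1 (A : finComNzRingType) (g : A) : is_ideal (ideal1 g).
Proof.
split=> [|x y /imsetP[a _ ->] /imsetP[b _ ->]|a x /imsetP[b _ ->]].
- by apply/imsetP; exists 0; rewrite ?mul0r.
- by apply/imsetP; exists (a + b); rewrite ?mulrDl.
- by apply/imsetP; exists (a * b); rewrite ?mulrA.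
Qed.

Lemma is_ideal_ideal2 (A : finComNzRingType) (x y : A) : is_ideal (ideal2 x y).
Proof.
split=> [|u v /imset2P[a b _ _ ->] /imset2P[c d _ _ ->]|c u /imset2P[a b _ _ ->]].
- by apply/imset2P; exists 0 0; rewrite ?mul0r ?addr0.
- by apply/imset2P; exists (a + c) (b + d); rewrite // !mulrDl addrACA.
- by apply/imset2P; exists (c * a) (c * b); rewrite // mulrDr !mulrA.
Qed.

Lemma idealB (A : finComNzRingType) (I : {set A}) x y :
  is_ideal I -> x \in I -> y \in I -> x - y \in I.
Proof.
by case=> _ ID IM Ix Iy; rewrite ID // -mulN1r IM.
Qed.

Section MaximalIdeal.

Variables (R : finComNzRingType) (gamma : R).
Hypothesis gamma_max : maximal_ideal (ideal1 gamma).

Lemma maximal_ideal1_inverse x : x \notin ideal1 gamma ->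
  exists y, y * x - 1 \in ideal1 gamma.
Proof.
move=> Ix; have [_ _ maxM] := gamma_max.
pose I : {set R} := ideal2 x gamma.
have idI : is_ideal I := is_ideal_ideal2 x gamma.
have sMI : ideal1 gamma \subset I.
  apply/subsetP=> _ /imsetP[b _ ->]; apply/imset2P; exists 0 b => //.
  by rewrite mul0r add0r.
have Ix' : x \in I.
  by apply/imset2P; exists 1 0; rewrite ?mul1r ?mul0r ?addr0.
have [EI|EI] := maxM I idI sMI; first by rewrite -EI Ix' in Ix.
have : 1 \in I by rewrite EI inE.
case/imset2P=> a b _ _ ->; exists a; apply/imsetP; exists (- b) => //.
by rewrite opprD addNKr mulNr.
Qed.

Lemma maximal_ideal1_proper : 1 \notin ideal1 gamma.
Proof.
have [_ neT _] := gamma_max; apply/negP=> I1; apply: neT; apply/setP=> x.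
by rewrite inE; have [_ _ /(_ x 1 I1)] := is_ideal_ideal1 gamma; rewrite mulr1.
Qed.

(** Polynomial division, gcds and Bezout relations are needed modulo gamma, so the
    quotient has to carry a genuine field structure. *)
Lemma residue_field_exists : exists (K : fieldType) (pi : {rmorphism R -> K}),
  (forall y, exists x, pi x = y) /\
  (forall x, pi x = 0 <-> x \in ideal1 gamma).
Proof.
pose I : R -> bool := fun x => x \in ideal1 gamma.
have id1 := is_ideal_ideal1 gamma.
have clI : idealr_closed I.
  split; [by case: id1 | exact: maximal_ideal1_proper | ].
  by move=> a u v Iu Iv; have [_ ID IM] := id1; apply: ID => //; apply: IM.
pose J : idealr R := HB.pack I (isIdealr.Build R I clI).
pose Q : comNzRingType := {ideal_quot J}.
pose pi : {rmorphism R -> Q} := \pi_({ideal_quot J})%qT.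
have pi_surj (y : Q) : exists x, pi x = y.
  by exists (repr y); rewrite /pi /= reprK.
have pi_ker x : pi x = 0 <-> x \in ideal1 gamma.
  have -> : (x \in ideal1 gamma) = (pi x == pi 0).
    by rewrite /pi /= -Quotient.idealrBE subr0.
  by rewrite rmorph0; split=> [->|/eqP].
have inv_ex (y : Q) : y != 0 -> exists z, z * y == 1.
  have [x <-] := pi_surj y => nz.
  have [|z Iz] := @maximal_ideal1_inverse x.
    by apply/negP=> /pi_ker/eqP; rewrite (negPf nz).
  exists (pi z); rewrite -rmorphM -subr_eq0 -(rmorph1 pi) -rmorphB.
  by apply/eqP/pi_ker.
pose inv (y : Q) : Q :=
  if boolP (y != 0) is AltTrue nz then xchoose (inv_ex y nz) else 0.
have invP (y : Q) : y != 0 -> inv y * y = 1.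
  rewrite /inv; case: {-}_ / boolP => [nz _|/negP //].
  exact/eqP/(xchooseP (inv_ex y nz)).
have inv0 : inv 0 = 0.
  by rewrite /inv; case: {-}_ / boolP => // nz; case/eqP: (nz).
pose K : fieldType := HB.pack (Quotient.quot J)
  (GRing.ComNzRing_isField.Build Q invP inv0).
by exists K, pi.
Qed.

Hypotheses (gamma_neq0 : gamma <> 0) (gamma_sq : gamma ^+ 2 = 0).

(** The annihilator contains gamma because gamma ^ 2 = 0, and it is proper because
    gamma <> 0; maximality leaves no room. *)
Lemma annihilator_gamma x : (x * gamma == 0) = (x \in ideal1 gamma).
Proof.
apply/eqP/idP=> [x0|/imsetP[a _ ->]]; last by rewrite -mulrA -expr2 gamma_sq mulr0.
apply/negPn/negP=> /maximal_ideal1_inverse[y /imsetP[a _ E]].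
apply: gamma_neq0; move/(congr1 ( *%R^~ gamma)): E.
rewrite mulrBl -!mulrA x0 -expr2 gamma_sq !mulr0 mul1r sub0r.
by move/eqP; rewrite oppr_eq0 => /eqP.
Qed.

(** Multiplication by gamma has image and kernel both equal to gamma R. *)
Lemma card_chain_ring : #|R| = (#|ideal1 gamma| ^ 2)%N.
Proof.
rewrite -cardsT (@card_fibred _ _ (fun x => x * gamma) _ (ideal1 gamma)).
  congr (_ * _)%N; apply: eq_card => u.
  by apply/imsetP/imsetP=> -[a _ ->]; exists a.
by move=> x _ y; rewrite inE /= -subr_eq0 -mulrBl annihilator_gamma.
Qed.

(** |R| is the index of gamma R times its order, and also the square of its order. *)
Lemma card_ideal_gamma q : #|cosets (ideal1 gamma)| = q ->
  #|ideal1 gamma| = q.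
Proof.
move=> <-; apply/eqP; rewrite -(@eqn_pmul2r #|ideal1 gamma|); last first.
  by apply/card_gt0P; exists 0; case: (is_ideal_ideal1 gamma).
rewrite mulnn -card_chain_ring -cardsT; apply/eqP.
have idg := is_ideal_ideal1 gamma; have [I0 ID _] := idg.
pose coset_of x := [set x + z | z in ideal1 gamma].
have -> : cosets (ideal1 gamma) = coset_of @: [set: R].
  by apply/setP=> u; apply/imsetP/imsetP=> -[x _ ->]; exists x; rewrite ?inE.
apply: card_fibred => x _ y; rewrite inE /=; apply/eqP/idP=> [E|Iyx].
  have : y \in coset_of x by rewrite -E; apply/imsetP; exists 0; rewrite ?addr0.
  by case/imsetP=> z Iz ->; rewrite addrC addKr.
apply/setP=> u; apply/imsetP/imsetP=> -[z Iz ->].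
  by exists ((y - x) + z); [exact: ID | ring].
exists (z - (y - x)); [exact: idealB | ring].
Qed.

End MaximalIdeal.

(** * Reduction of polynomials modulo gamma *)

Lemma dvdp_exp_irreducible (K : fieldType) (f d : {poly K}) N :
  irreducible_poly f -> d %| f ^+ N -> exists2 j, (j <= N)%N & d %= f ^+ j.
Proof.
move=> irr_f; elim: N d => [|N IHN] d.
  by rewrite expr0 dvdp1 size_poly_eq1 => d1; exists 0%N.
have [cop_df|] := boolP (coprimep d f).
  move=> dv; exists 0%N => //; rewrite -size_poly_eq1.
  have : coprimep d (f ^+ N.+1) by apply: coprimep_expr.
  by move/coprimepP=> /(_ d (dvdpp d) dv); rewrite -size_poly_eq1.
rewrite coprimep_def => /irr_f /(_ (dvdp_gcdr d f)) /eqp_dvdl f_gcd.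
have /dvdpP[e ->] : f %| d by rewrite -f_gcd dvdp_gcdl.
rewrite exprSr dvdp_mul2r ?irredp_neq0 // => /IHN[j le_j e_f].
by exists j.+1 => //; rewrite exprSr eqp_mul2r ?irredp_neq0.
Qed.

Lemma separable_XnsubC (K : fieldType) n (a : K) :
  n%:R != 0 :> K -> a != 0 -> separable_poly ('X^n - a%:P).
Proof.
move=> n_neq0 a_neq0; rewrite unlock derivB derivC subr0 derivXn.
set c := a^-1 / n%:R; apply/Bezout_eq1_coprimepP.
exists (- a^-1%:P, c%:P * 'X) => /=.
have cn : c%:P * n%:R = a^-1%:P by rewrite -polyC_natr -polyCM divfK.
have aa : a^-1%:P * a%:P = 1 :> {poly K} by rewrite -polyCM mulVf.
case: n n_neq0 @c cn => [|n] n_neq0 c cn; first by rewrite eqxx in n_neq0.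
rewrite -mulr_natl exprS.
have -> : - a^-1%:P * ('X * 'X^n - a%:P) + c%:P * 'X * (n.+1%:R * 'X^n)
  = a^-1%:P * a%:P + (c%:P * n.+1%:R - a^-1%:P) * ('X * 'X^n) by ring.
by rewrite cn subrr mul0r addr0.
Qed.

Section Reduction.

Variables (R : comNzRingType) (K : fieldType) (pi : {rmorphism R -> K}).
Variable gamma : R.
Hypothesis pi_surj : forall y, exists x, pi x = y.
Hypothesis pi_ker : forall x, pi x = 0 -> exists a, x = a * gamma.
Hypothesis pi_ann : forall x, x * gamma = 0 -> pi x = 0.
Hypothesis gamma_sq : gamma ^+ 2 = 0.

Local Notation "p ^pi" := (map_poly pi p) (at level 2, format "p ^pi").

Lemma pi_gamma : pi gamma = 0.
Proof. by apply: pi_ann; rewrite -expr2. Qed.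

Lemma red_gammaZ (p : {poly R}) : (gamma *: p)^pi = 0.
Proof. by rewrite map_polyZ /= pi_gamma scale0r. Qed.

Lemma gammaZ_gammaZ (p : {poly R}) : gamma *: (gamma *: p) = 0.
Proof. by rewrite scalerA -expr2 gamma_sq scale0r. Qed.

Lemma red_lift (q : {poly K}) : exists p, p^pi = q.
Proof.
have ex y : exists x, pi x == y by have [x <-] := pi_surj y; exists x.
exists (\poly_(i < size q) xchoose (ex q`_i)).
apply/polyP=> i; rewrite coef_map coef_poly.
case: ltnP => [_|le_qi]; first exact/eqP/(xchooseP (ex q`_i)).
by rewrite raddf0 nth_default.
Qed.

Lemma red_eq0 (p : {poly R}) : p^pi = 0 ->
  exists2 p', p = gamma *: p' & (size p' <= size p)%N.
Proof.
move=> p0; have ex i : exists a, p`_i == a * gamma.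
  have /pi_ker[a ->] : pi p`_i = 0 by rewrite -coef_map p0 coef0.
  by exists a.
exists (\poly_(i < size p) xchoose (ex i)); last exact: size_poly.
apply/polyP=> i; rewrite coefZ coef_poly.
case: ltnP => [_|le_pi]; last by rewrite mulr0 nth_default.
by rewrite mulrC; apply/eqP/(xchooseP (ex i)).
Qed.

Lemma red_eq (p q : {poly R}) : p^pi = q^pi -> exists e, p = q + gamma *: e.
Proof.
move=> Epq; have [|e Ee _] := @red_eq0 (p - q).
  by rewrite rmorphB /= Epq subrr.
by exists e; rewrite -Ee addrC subrK.
Qed.

Lemma red_ann (p : {poly R}) : gamma *: p = 0 -> p^pi = 0.
Proof.
move=> p0; apply/polyP=> i; rewrite coef_map coef0; apply: pi_ann.
by rewrite mulrC -coefZ p0 coef0.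
Qed.

Lemma red_invertible (p : {poly R}) : invertible p -> size p^pi = 1%N.
Proof.
case=> q pq1; apply/eqP; rewrite -dvdp1.
by rewrite -(rmorph1 (map_poly pi)) -pq1 rmorphM dvdp_mulr.
Qed.

(** Hensel lifting in one step, which suffices as gamma ^ 2 = 0: if f reduces to c d
    with u c + v d = 1, and A, B, U, V lift c, d, u, v, then f = A B + gamma E
    for some E, and
    f = (A + gamma V E) (B + gamma U E). The degrees of the lifts are irrelevant,
    because a unit of R[x] reduces to a nonzero constant. *)
Lemma irreducible_red (f : {poly R}) :
  irreducible_elt f -> separable_poly f^pi -> (1 < size f^pi)%N ->
  irreducible_poly f^pi.
Proof.
case=> _ _ irr_f sep_f f_gt1; split=> // d d_neq1 /dvdpP[c f_cd].
have /Bezout_eq1_coprimepP[[u v] /= uv1] : coprimep c d.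
  by apply: separable_coprime sep_f _; rewrite f_cd dvdpp.
have [A Ac] := red_lift c; have [B Bd] := red_lift d.
have [|E fE] := @red_eq f (A * B); first by rewrite rmorphM /= Ac Bd.
have [U Uu] := red_lift u; have [V Vv] := red_lift v.
have [|E' E1] := @red_eq (U * A + V * B) 1.
  by rewrite rmorphD !rmorphM rmorph1 /= Ac Bd Uu Vv.
have : f = (A + gamma *: (V * E)) * (B + gamma *: (U * E)).
  rewrite fE -!mul_polyC; set g := gamma%:P.
  have g2 : g * g = 0 by rewrite -polyCM -expr2 gamma_sq.
  have -> : (A + g * (V * E)) * (B + g * (U * E)) =
    A * B + g * E * (U * A + V * B) + g * g * (V * E * U * E) by ring.
  rewrite E1 -mul_polyC -/g g2 mul0r addr0 mulrDr mulr1.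
  have -> : g * E * (g * E') = g * g * (E * E') by ring.
  by rewrite g2 mul0r addr0.
have red_add (p q : {poly R}) : (p + gamma *: q)^pi = p^pi.
  by rewrite rmorphD /= red_gammaZ addr0.
case/irr_f => /red_invertible; rewrite red_add ?Ac ?Bd => sz1.
  have /eqP := sz1; rewrite size_poly_eq1 f_cd => c1.
  by rewrite -[d in d %= _]mul1r eqp_mulr // eqp_sym.
by rewrite sz1 in d_neq1.
Qed.

End Reduction.

(** Translation by 1 permutes R, so it does not change the sum of all elements. *)
Lemma card_natr_eq0 (R : finNzRingType) : #|R|%:R = 0 :> R.
Proof.
have E : \sum_(x : R) (x + 1) = \sum_(x : R) x.
  by rewrite [RHS](reindex_inj (addIr 1)).
by move: E; rewrite big_split /= sumr_const -[RHS]addr0 => /addrI.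
Qed.

Lemma XnsubC_exp_pchar (K : fieldType) p n s (a : K) : p \in [pchar K] ->
  ('X^n - a%:P) ^+ (p ^ s) = 'X^(n * p ^ s) - (a ^+ (p ^ s))%:P.
Proof.
move=> Kp; have pnat_s : [pchar {poly K}].-nat (p ^ s)%N.
  by rewrite pnatX pnatE ?(pcharf_prime Kp) // pchar_poly Kp.
by rewrite exprDn_pchar // exprNn_pchar // -exprM polyC_exp.
Qed.

(** * Quotients by a monic polynomial *)

Lemma mk_monic_id (R : nzRingType) (h : {poly R}) :
  h \is monic -> (1 < size h)%N -> mk_monic h = h.
Proof. by move=> h_monic h_gt1; rewrite /mk_monic h_gt1 h_monic. Qed.

Lemma in_qpoly_eq0 (R : comNzRingType) (h p : {poly R}) :
  h \is monic -> (1 < size h)%N ->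
  in_qpoly h p = 0 <-> exists q, p = q * h.
Proof.
move=> hM h1; have mk := mk_monic_id hM h1.
split=> [/(congr1 val) /= | [q ->]].
  rewrite mk => p0; exists (Pdiv.CommonRing.rdivp p h).
  by rewrite {1}(Pdiv.RingMonic.rdivp_eq hM p) p0 addr0.
by apply: val_inj; rewrite /= mk Pdiv.RingMonic.rmodp_mull.
Qed.

Lemma in_qpoly_eq (R : comNzRingType) (h p q : {poly R}) :
  h \is monic -> (1 < size h)%N ->
  in_qpoly h p = in_qpoly h q -> exists b, p = q + b * h.
Proof.
move=> hM h1 /eqP; rewrite -subr_eq0 -rmorphB => /eqP/in_qpoly_eq0.
by case=> // b Eb; exists b; rewrite -Eb addrC subrK.
Qed.

Lemma in_qpolyK (R : nzRingType) (h : {poly R}) (c : {poly %/ h}) :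
  in_qpoly h c = c.
Proof. by apply/val_inj/in_qpoly_small/size_mk_monic. Qed.

(** * Counting codewords by their leading coefficient *)

Section LowDegree.

Variables (R : finComNzRingType) (h : {poly R}).
Local Notation Q := {poly %/ h}.
Variable C : {set Q}.
Hypothesis C_ideal : is_ideal C.

Lemma wRT_size (c : Q) : wRT c = size (c : {poly R}).
Proof.
rewrite /wRT -val_eqE /=; case: eqP => [->|/eqP c0]; first by rewrite size_poly0.
by rewrite add1n prednK // size_poly_gt0.
Qed.

Definition deg_lt r : {set Q} := [set c in C | (size (c : {poly R}) <= r)%N].

(** The coefficients are taken in degree r for all codewords of degree at most r, so
    that 0 is included and the set is the image of an additive map. *)
Definition lead_coefs r : {set R} := [set (c : {poly R})`_r | c : Q in deg_lt r.+1].

Lemma card_deg_lt0 : #|deg_lt 0| = 1%N.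
Proof.
apply/eqP/cards1P; exists 0; apply/setP=> c; rewrite !inE size_poly_leq0.
rewrite (val_eqE c 0); case: eqP => [->|_]; rewrite ?andbF ?andbT //.
by case: C_ideal.
Qed.

Lemma num_weight0 : num_weight C 0 = 1%N.
Proof.
rewrite -card_deg_lt0; apply: eq_card => c.
by rewrite !inE wRT_size leqn0.
Qed.

Lemma num_weightS r : num_weight C r.+1 = (#|deg_lt r.+1| - #|deg_lt r|)%N.
Proof.
have sub : deg_lt r \subset deg_lt r.+1.
  by apply/subsetP=> c; rewrite !inE => /andP[-> /leqW].
rewrite -(setIidPr sub) -cardsD; apply: eq_card => c.
rewrite !inE wRT_size eqn_leq; case: (c \in C); rewrite ?andbF //=.
by rewrite -ltnNge andbC.
Qed.

(** Taking the coefficient of degree r is additive, with kernel [deg_lt r]. *)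
Lemma card_deg_ltS r : #|deg_lt r.+1| = (#|lead_coefs r| * #|deg_lt r|)%N.
Proof.
apply: card_fibred => x; rewrite !inE => /andP[Cx sx] y.
have [_ CD _] := C_ideal; rewrite !inE; apply/andP/andP.
  case=> /andP[Cy sy] /eqP E; split; first exact: idealB.
  apply/leq_sizeP => j; rewrite leq_eqVlt => /predU1P[<-|lt_j] /=.
    by rewrite coefB E subrr.
  by rewrite coefB !nth_default ?subr0 // (leq_trans _ lt_j).
case=> Cyx syx; rewrite -(subrK x y); split.
  rewrite CD //= (leq_trans (size_polyD _ _)) // geq_max sx andbT.
  exact: leqW.
by rewrite /= coefD (nth_default _ syx) add0r.
Qed.

End LowDegree.

Section ConstacyclicIdeals.

Variables (R : finComNzRingType) (K : fieldType) (pi : {rmorphism R -> K}).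
Variable gamma : R.
Hypothesis pi_surj : forall y, exists x, pi x = y.
Hypothesis pi_ker : forall x, pi x = 0 -> exists a, x = a * gamma.
Hypothesis pi_ann : forall x, x * gamma = 0 -> pi x = 0.
Hypothesis gamma_sq : gamma ^+ 2 = 0.

Local Notation "p ^pi" := (map_poly pi p) (at level 2, format "p ^pi").

Variables (h f : {poly R}) (n P : nat).
Hypotheses (h_monic : h \is monic) (size_h : size h = (n * P).+1).
Hypotheses (f_monic : f \is monic) (size_f : size f = n.+1).
Hypotheses (nP_gt0 : (0 < n * P)%N) (h_red : h^pi = f^pi ^+ P).

Local Notation Q := {poly %/ h}.
Local Notation "[ p ]" := (in_qpoly h p).

Let h_gt1 : (1 < size h)%N. Proof. by rewrite size_h. Qed.

Lemma size_fX k : size (f ^+ k) = (n * k).+1.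
Proof.
elim: k => [|k IHk]; first by rewrite expr0 size_poly1 muln0.
rewrite exprS size_monicM ?monic_neq0 ?monic_exp // IHk size_f mulnS.
by rewrite addSn addnS.
Qed.

Lemma size_fX_red k : size (f^pi ^+ k) = (n * k).+1.
Proof.
rewrite -rmorphXn /= size_map_poly_id0 ?size_fX //.
by rewrite (monicP (monic_exp k f_monic)) rmorph1 oner_eq0.
Qed.

Lemma in_qpoly_repr (p : {poly R}) : (size p <= n * P)%N -> [p] = p :> {poly R}.
Proof.
move=> sp; apply: in_qpoly_small.
by rewrite (mk_monic_id h_monic h_gt1) size_h ltnS.
Qed.

(** Together the clauses say that fbar ^ w generates the reduction of C in
    K[x] / fbar ^ P, and fbar ^ k its torsion, the reductions of the p with gamma p
    in C. Quantifying over representatives in R[x] keeps the divisibilities in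
    K[x]; the last two clauses say that the generators are reached. *)
Definition residue_torsion (C : {set Q}) w k : Prop :=
  [/\ (k <= w <= P)%N,
      forall p, [p] \in C -> f^pi ^+ w %| p^pi,
      forall p, [gamma *: p] \in C -> f^pi ^+ k %| p^pi,
      [gamma *: f ^+ k] \in C
    & exists e, [f ^+ w + gamma *: e] \in C].

(** Multiply c p by a x ^ (r - d): below degree n P no reduction modulo h occurs. *)
Lemma lead_coefs_monic (C : {set Q}) c p d r : is_ideal C ->
  [c *: p] \in C -> p \is monic -> size p = d.+1 -> (d <= r < n * P)%N ->
  forall a, a * c \in lead_coefs C r.
Proof.
move=> [_ _ CM] Ccp p_monic size_p /andP[le_dr lt_r] a.
pose u := 'X^(r - d) * p.
have u_monic : u \is monic by rewrite monicMl ?monicXn.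
have size_u : size u = r.+1.
  by rewrite size_monicM ?monicXn ?monic_neq0 // size_polyXn size_p addSn addnS subnK.
have size_acu : (size ((a * c) *: u) <= r.+1)%N.
  by rewrite -size_u size_scale_leq.
apply/imsetP; exists [(a * c) *: u]; last first.
  rewrite in_qpoly_repr ?(leq_trans size_acu) // coefZ.
  by move/monicP: u_monic; rewrite lead_coefE size_u /= => ->; rewrite mulr1.
rewrite inE in_qpoly_repr ?(leq_trans size_acu) // andbT.
have -> : (a * c) *: u = (a *: 'X^(r - d)) * (c *: p).
  by rewrite -scalerAl -scalerAr scalerA.
by rewrite in_qpolyM CM.
Qed.

Section Ideal.

Variables (C : {set Q}) (w k : nat).
Hypotheses (C_ideal : is_ideal C) (C_rt : residue_torsion C w k).

(** The reduction is a multiple of fbar ^ w of degree less than n w. *)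
Lemma deg_lt_residue0 r c : (r < n * w)%N -> c \in deg_lt C r.+1 ->
  exists2 p, (c : {poly R}) = gamma *: p & (size p <= r.+1)%N.
Proof.
move=> lt_r; rewrite inE => /andP[Cc sc].
have [_ Cw _ _ _] := C_rt; rewrite -(in_qpolyK c) in Cc.
have c0 : (c : {poly R})^pi = 0.
  apply/eqP/negPn/negP=> nz; have := dvdp_leq nz (Cw _ Cc).
  rewrite size_fX_red leqNgt ltnS => /negP[].
  by rewrite (leq_trans (size_poly _ _)) // (leq_trans sc).
have [p Ep sp] := red_eq0 pi_ker c0; exists p => //.
exact: leq_trans sp sc.
Qed.

Lemma lead_coefs_small r : (r < n * k)%N -> lead_coefs C r = [set 0].
Proof.
move=> lt_r; have [/andP[le_kw _] _ Ck _ _] := C_rt.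
apply/setP=> a; rewrite inE; apply/imsetP/eqP=> [[c lt_c ->]|->]; last first.
  exists 0; rewrite ?coef0 // inE size_poly0 /=.
  by rewrite andbT; case: C_ideal.
have [|p Ep sp] := @deg_lt_residue0 r c _ lt_c.
  by rewrite (leq_trans lt_r) // leq_mul2l le_kw orbT.
move: lt_c; rewrite inE => /andP[Cc _].
rewrite -(in_qpolyK c) Ep in Cc.
have p0 : p^pi = 0.
  apply/eqP/negPn/negP=> nz; have := dvdp_leq nz (Ck _ Cc).
  rewrite size_fX_red leqNgt ltnS => /negP[].
  by rewrite (leq_trans (size_poly _ _)) // (leq_trans sp).
have [p' Ep' _] := red_eq0 pi_ker p0.
by rewrite Ep Ep' gammaZ_gammaZ // coef0.
Qed.

Lemma lead_coefs_middle r : (n * k <= r < n * w)%N ->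
  lead_coefs C r = ideal1 gamma.
Proof.
case/andP=> le_r lt_r; have [/andP[_ le_wP] _ _ Cg _] := C_rt.
apply/setP=> a; apply/idP/idP=> [/imsetP[c lt_c ->]|/imsetP[b _ ->]].
  have [p -> _] := deg_lt_residue0 lt_r lt_c.
  by apply/imsetP; exists (p`_r); rewrite // coefZ mulrC.
apply: lead_coefs_monic C_ideal Cg _ (size_fX k) _ b; first exact: monic_exp.
by rewrite le_r (leq_trans lt_r) // leq_mul2l le_wP orbT.
Qed.

(** From f ^ w + gamma e in C, remove multiples of gamma f ^ k until e has degree less
    than n k <= n w; the leading term is then that of f ^ w. *)
Lemma residue_torsion_monic : exists2 p, [p] \in C &
  p \is monic /\ size p = (n * w).+1.
Proof.
have [/andP[le_kw _] _ _ Cg [e Ce]] := C_rt.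
have fk_monic : f ^+ k \is monic by exact: monic_exp.
pose r := Pdiv.CommonRing.rmodp e (f ^+ k).
have size_r : (size (gamma *: r) < size (f ^+ w))%N.
  rewrite (leq_ltn_trans (size_scale_leq _ _)) // (@leq_trans (size (f ^+ k))) //.
    by apply: Pdiv.CommonRing.ltn_rmodpN0; exact: monic_neq0.
  by rewrite !size_fX ltnS leq_mul2l le_kw orbT.
exists (f ^+ w + gamma *: r).
  have -> : f ^+ w + gamma *: r =
     (f ^+ w + gamma *: e) -
     Pdiv.CommonRing.rdivp e (f ^+ k) * (gamma *: f ^+ k).
    rewrite {1}(Pdiv.RingMonic.rdivp_eq fk_monic e) scalerDr scalerAr -/r.
    by rewrite [_ * _ + _]addrC addrA addrK.
  by rewrite rmorphB /= in_qpolyM idealB //; case: C_ideal => _ _; apply.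
rewrite size_polyDl // size_fX; split=> //.
by rewrite monicE lead_coefDl // -monicE monic_exp.
Qed.

Lemma lead_coefs_large r : (n * w <= r < n * P)%N -> lead_coefs C r = setT.
Proof.
move=> le_r; have [p Cp [p_monic size_p]] := residue_torsion_monic.
apply/setP=> a; rewrite inE -[a]mulr1; rewrite -[p]scale1r in Cp.
exact: lead_coefs_monic C_ideal Cp p_monic size_p le_r a.
Qed.

Variable q : nat.
Hypotheses (card_gammaR : #|ideal1 gamma| = q) (card_R : #|R| = (q ^ 2)%N).

Lemma card_deg_lt r : (r <= n * P)%N ->
  #|deg_lt C r| = (q ^ ((r - n * k) + (r - n * w)))%N.
Proof.
have [/andP[le_kw le_wP] _ _ _ _] := C_rt.
have le_nkw : (n * k <= n * w)%N by rewrite leq_mul2l le_kw orbT.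
elim: r => [|r IHr] lt_r; first by rewrite card_deg_lt0.
rewrite card_deg_ltS // IHr ?(ltnW lt_r) //.
have [lt_rk|le_kr] := ltnP r (n * k).
  rewrite lead_coefs_small // cards1 mul1n; congr (_ ^ _)%N; lia.
have [lt_rw|le_wr] := ltnP r (n * w).
  rewrite lead_coefs_middle ?le_kr // card_gammaR -expnS; congr (_ ^ _)%N; lia.
rewrite lead_coefs_large ?le_wr // cardsT card_R -expnD; congr (_ ^ _)%N; lia.
Qed.

(** The counts are the increments of r |-> q ^ ((r - n k) + (r - n w)), with truncated
    subtractions. *)
Lemma num_weight_residue_torsion r : (r <= n * P)%N ->
  num_weight C r =
    if r == 0%N then 1%N
    else if (r <= n * k)%N then 0%N
    else if (r <= n * w)%N then ((q - 1) * q ^ (r - n * k - 1))%N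
    else ((q ^ 2 - 1) * q ^ (2 * r - n * w - n * k - 2))%N.
Proof.
have [/andP[le_kw le_wP] _ _ _ _] := C_rt.
have le_nkw : (n * k <= n * w)%N by rewrite leq_mul2l le_kw orbT.
case: r => [|r] lt_r; first exact: num_weight0.
rewrite num_weightS !card_deg_lt ?(ltnW lt_r) //=.
have [lt_rk|le_kr] := ltnP r (n * k).
  have -> : (r.+1 - n * k + (r.+1 - n * w) = r - n * k + (r - n * w))%N by lia.
  by rewrite subnn.
have [lt_rw|le_wr] := ltnP r (n * w).
  rewrite mulnBl mul1n -expnS; congr (_ ^ _ - _ ^ _)%N; lia.
rewrite mulnBl mul1n -expnD; congr (_ ^ _ - _ ^ _)%N; lia.
Qed.

End Ideal.

(** * Residue and torsion of each type of ideal *)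

Lemma mem_ideal1P (p u : {poly R}) : [p] \in ideal1 [u] ->
  exists a b, p = a * u + b * h.
Proof.
case/imsetP=> a _; rewrite -[a]in_qpolyK -in_qpolyM => /in_qpoly_eq[] // b ->.
by exists (polyn a), b.
Qed.

Lemma mem_ideal2P (p u v : {poly R}) : [p] \in ideal2 [u] [v] ->
  exists a b c, p = a * u + b * v + c * h.
Proof.
case/imset2P=> a b _ _.
rewrite -[a]in_qpolyK -[b]in_qpolyK -!in_qpolyM -in_qpolyD.
by case/in_qpoly_eq=> // c ->; exists (polyn a), (polyn b), c.
Qed.

Lemma in_qpoly_h_mul a : [a * h] = 0.
Proof. by apply/in_qpoly_eq0 => //; exists a. Qed.

Lemma in_qpoly_h : [h] = 0.
Proof. by rewrite -(in_qpoly_h_mul 1) mul1r. Qed.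

(** Modulo gamma the relation says that b h vanishes, so gamma divides b, as hbar is
    nonzero; cancelling gamma leaves a relation modulo gamma. *)
Lemma torsion_cancel p c b : gamma *: p = gamma *: c + b * h ->
  f^pi ^+ P %| p^pi - c^pi.
Proof.
move=> E; have bh0 : b^pi * h^pi = 0.
  rewrite -rmorphM /=; have -> : b * h = gamma *: (p - c).
    by rewrite scalerBr E addrC addKr.
  exact: red_gammaZ.
have h_neq0 : h^pi != 0.
  rewrite -size_poly_eq0 size_map_poly_id0 ?size_h //.
  by rewrite (monicP h_monic) rmorph1 oner_eq0.
move/eqP: bh0; rewrite mulf_eq0 (negPf h_neq0) orbF => /eqP b0.
have [b' Eb _] := red_eq0 pi_ker b0.
have /red_ann : gamma *: (p - c - b' * h) = 0.
  by rewrite !scalerBr E Eb -scalerAl [X in X - _ - _]addrC addrK subrr.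
move/(_ _ _ pi_ann); rewrite !rmorphB rmorphM /= h_red => /eqP.
by rewrite subr_eq0 => /eqP->; rewrite dvdp_mull.
Qed.

(** f ^ P need not vanish in R[x] / h: when R has characteristic p ^ 2 it is only a
    multiple of gamma. *)
Lemma h_eq_fP : exists e, h = f ^+ P + gamma *: e.
Proof. by apply: (red_eq pi_ker); rewrite h_red rmorphXn. Qed.

Lemma gammaZ_fP : [gamma *: f ^+ P] = 0.
Proof.
have [e Eh] := h_eq_fP; rewrite -(in_qpoly_h_mul gamma%:P); congr in_qpoly.
by rewrite mul_polyC Eh scalerDr gammaZ_gammaZ // addr0.
Qed.

(** The pair (P, P) stands for the zero ideal because fbar ^ P = hbar. *)
Lemma residue_torsion0 : residue_torsion [set 0] P P.
Proof.
split=> [|p|p||]; rewrite ?leqnn //.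
- by rewrite inE => /eqP/in_qpoly_eq0[] // b ->; rewrite rmorphM /= h_red dvdp_mull.
- rewrite inE => /eqP/in_qpoly_eq0[] // b Eb.
  rewrite -[p^pi]subr0 -(rmorph0 (map_poly pi)).
  by apply: torsion_cancel; rewrite scaler0 add0r Eb.
- by rewrite inE gammaZ_fP.
- by have [e Eh] := h_eq_fP; exists e; rewrite -Eh in_qpoly_h inE.
Qed.

Lemma residue_torsion1 : residue_torsion (ideal1 1) 0 0.
Proof.
have all_in (c : Q) : c \in ideal1 1.
  by apply/imsetP; exists c; rewrite ?mulr1.
split=> // [p _|p _|]; rewrite ?expr0 ?dvd1p //.
by exists 0; apply: all_in.
Qed.

Lemma residue_torsion_gamma tau : (tau <= P)%N ->
  residue_torsion (ideal1 [gamma *: f ^+ tau]) P tau.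
Proof.
move=> le_tau; split=> [|p|p||]; rewrite ?le_tau ?leqnn //.
- case/mem_ideal1P=> a [b ->]; rewrite rmorphD !rmorphM /= red_gammaZ //.
  by rewrite mulr0 add0r h_red dvdp_mull.
- case/mem_ideal1P=> a [b]; rewrite -scalerAr => /torsion_cancel.
  rewrite rmorphM rmorphXn /= => /(dvdp_trans (dvdp_exp2l _ le_tau)).
  by rewrite dvdp_subl // dvdp_mull.
- by apply/imsetP; exists 1; rewrite ?mul1r.
- have [e Eh] := h_eq_fP; exists e; rewrite -Eh in_qpoly_h.
  by case: (is_ideal_ideal1 [gamma *: f ^+ tau]).
Qed.

Hypothesis irr_f : irreducible_poly f^pi.

(** The torsion element p may be replaced by gcd(pbar, fbar ^ P), which is a
    power fbar ^ j as fbar is irreducible. The Bezout relation lifts to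
    f ^ j = U p + V h + gamma e, whence gamma f ^ j lies in C and k <= j. *)
Lemma torsion_minimal (C : {set Q}) k : is_ideal C ->
  (forall j, [gamma *: f ^+ j] \in C -> (k <= j)%N) ->
  forall p, [gamma *: p] \in C -> f^pi ^+ k %| p^pi.
Proof.
move=> [_ _ CM] k_min p Cp.
have [j _ gcd_j] := dvdp_exp_irreducible irr_f (dvdp_gcdr p^pi (f^pi ^+ P)).
suff le_kj : (k <= j)%N.
  apply: dvdp_trans (dvdp_exp2l _ le_kj) _.
  by rewrite -(eqp_dvdl _ gcd_j) dvdp_gcdl.
apply: k_min.
have [u [v Euv]] : exists u v, u * p^pi + v * f^pi ^+ P = f^pi ^+ j.
  have [[u v] /= uv_gcd] := Bezoutp p^pi (f^pi ^+ P).
  have /eqpf_eq[c c_neq0 E] := eqp_trans uv_gcd gcd_j.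
  exists (c^-1 *: u), (c^-1 *: v).
  by rewrite -!scalerAl -scalerDr E scalerA mulVf // scale1r.
have [U EU] := red_lift pi_surj u; have [V EV] := red_lift pi_surj v.
have [|e Ee] := @red_eq _ _ pi _ pi_ker (f ^+ j) (U * p + V * h).
  by rewrite rmorphD !rmorphM rmorphXn /= EU EV h_red.
have -> : gamma *: f ^+ j = U * (gamma *: p) + (gamma *: V) * h.
  by rewrite Ee !scalerDr gammaZ_gammaZ // addr0 scalerAr scalerAl.
by rewrite in_qpolyD in_qpoly_h_mul addr0 in_qpolyM CM.
Qed.

Section KappaGenerator.

Variables (w k : nat) (e : {poly R}).
Hypothesis lt_wP : (w < P)%N.
Local Notation M := [f ^+ w + gamma *: e].
Hypothesis k_in : [gamma *: f ^+ k] \in ideal1 M.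
Hypothesis k_min : forall j, [gamma *: f ^+ j] \in ideal1 M -> (k <= j)%N.

(** gamma (f ^ w + gamma e) = gamma f ^ w lies in the ideal. *)
Lemma kappa_le_omega : (k <= w)%N.
Proof.
apply: k_min; apply/imsetP; exists [gamma%:P] => //.
rewrite -in_qpolyM; congr in_qpoly.
by rewrite mul_polyC scalerDr gammaZ_gammaZ // addr0.
Qed.

Lemma residue_torsion_main : residue_torsion (ideal1 M) w k.
Proof.
split=> [|p|||].
- by rewrite kappa_le_omega ltnW.
- case/mem_ideal1P=> a [b ->].
  rewrite rmorphD !rmorphM rmorphD rmorphXn /= red_gammaZ // addr0 h_red.
  by rewrite dvdp_add ?dvdp_mull // dvdp_exp2l // ltnW.
- exact: torsion_minimal (is_ideal_ideal1 _) k_min.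
- exact: k_in.
- by exists e; apply/imsetP; exists 1; rewrite ?mul1r.
Qed.

(** If gamma p = a M + gamma b f ^ mu, then p - b f ^ mu is in the torsion of the ideal
    of M, hence is a multiple of fbar ^ k modulo gamma, and mu <= k. *)
Lemma residue_torsion_main2 mu : (mu <= k)%N ->
  residue_torsion (ideal2 M [gamma *: f ^+ mu]) w mu.
Proof.
move=> le_mu; split=> [|p|p||].
- by rewrite (leq_trans le_mu kappa_le_omega) ltnW.
- case/mem_ideal2P=> a [b [c ->]].
  rewrite !rmorphD !rmorphM rmorphD rmorphXn /= !red_gammaZ //.
  rewrite addr0 mulr0 addr0 h_red.
  by rewrite dvdp_add ?dvdp_mull // dvdp_exp2l // ltnW.
- case/mem_ideal2P=> a [b [c E]].
  have : [gamma *: (p - b * f ^+ mu)] \in ideal1 M.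
    apply/imsetP; exists [a] => //.
    rewrite scalerBr E scalerAr addrAC addrK.
    by rewrite in_qpolyD in_qpoly_h_mul addr0 in_qpolyM.
  move/(torsion_minimal (is_ideal_ideal1 _) k_min).
  move/(dvdp_trans (dvdp_exp2l _ le_mu)).
  by rewrite rmorphB rmorphM rmorphXn /= dvdp_subl // dvdp_mull.
- by apply/imset2P; exists 0 1; rewrite ?mul0r ?add0r ?mul1r.
- by exists e; apply/imset2P; exists 1 0; rewrite ?mul0r ?addr0 ?mul1r.
Qed.

End KappaGenerator.

End ConstacyclicIdeals.

(** * The weight distributions *)

Theorem theorem3p10 (R : finComNzRingType) (gamma zeta alpha alpha0 : R)
  (p m n s : nat)
  (p_prime : prime p)
  (R_chain : chain_ring R)
  (gamma_max : maximal_ideal (ideal1 gamma))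
  (gamma_neq0 : gamma <> 0)
  (gamma_sq : gamma ^+ 2 = 0)
  (residue_card : #|cosets (ideal1 gamma)| = (p ^ m)%N)
  (zeta_order : (p ^ m - 1).-primitive_root zeta)
  (n_gt0 : (0 < n)%N) (s_gt0 : (0 < s)%N) (n_coprime_p : coprime n p)
  (alpha_T : alpha \in teichmuller (p ^ m) zeta) (alpha_neq0 : alpha <> 0)
  (alpha0_T : alpha0 \in teichmuller (p ^ m) zeta)
  (alphaE : alpha = alpha0 ^+ (p ^ s))
  (irr : irreducible_elt (xn_sub n alpha0))
  (C : {set {poly %/ xn_sub (n * p ^ s) alpha}})
  (C_ideal : is_ideal C) :
  let h := xn_sub (n * p ^ s) alpha in
  let f : {poly %/ h} := in_qpoly h (xn_sub n alpha0) in
  let g : {poly %/ h} := in_qpoly h gamma%:P in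
  let T := teichmuller (p ^ m) zeta in
  (C = [set 0] ->
     forall rho : nat, (rho <= n * p ^ s)%N ->
     num_weight C rho = if rho == 0%N then 1%N else 0%N)
  /\ (C = ideal1 1 ->
     forall rho : nat, (rho <= n * p ^ s)%N ->
     num_weight C rho =
       if rho == 0%N then 1%N
       else ((p ^ (2 * m) - 1) * p ^ (2 * m * (rho - 1)))%N)
  /\ (forall tau : nat, typeII (p ^ s) f g tau C ->
     forall rho : nat, (rho <= n * p ^ s)%N ->
     num_weight C rho =
       if rho == 0%N then 1%N
       else if (rho <= n * tau)%N then 0%N
       else ((p ^ m - 1) * p ^ (m * (rho - n * tau - 1)))%N)
  /\ (forall (omega t : nat) (G : {poly %/ h}) (kappa : nat),
     typeIII n T (p ^ s) f g omega t G kappa C ->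
     forall rho : nat, (rho <= n * p ^ s)%N ->
     num_weight C rho =
       if rho == 0%N then 1%N
       else if (rho <= n * kappa)%N then 0%N
       else if (rho <= n * omega)%N then
         ((p ^ m - 1) * p ^ (m * (rho - n * kappa - 1)))%N
       else
         ((p ^ (2 * m) - 1)
            * p ^ (m * (2 * rho - n * omega - n * kappa - 2)))%N)
  /\ (forall (omega t : nat) (G : {poly %/ h}) (kappa mu : nat),
     typeIV n T (p ^ s) f g omega t G kappa mu C ->
     forall rho : nat, (rho <= n * p ^ s)%N ->
     num_weight C rho =
       if rho == 0%N then 1%N
       else if (rho <= n * mu)%N then 0%N
       else if (rho <= n * omega)%N then
         ((p ^ m - 1) * p ^ (m * (rho - n * mu - 1)))%N
       else
         ((p ^ (2 * m) - 1)
            * p ^ (m * (2 * rho - n * omega - n * mu - 2)))%N).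
Proof.
move=> h f g T.
have [K [pi [pi_surj pi_ker]]] := residue_field_exists gamma_max.
have pi_kerE x : pi x = 0 -> exists a, x = a * gamma.
  by case/pi_ker/imsetP=> a _ ->; exists a.
have pi_ann x : x * gamma = 0 -> pi x = 0.
  by move/eqP; rewrite annihilator_gamma // => /pi_ker.
have card_gammaR := card_ideal_gamma gamma_max gamma_neq0 gamma_sq residue_card.
have card_R : #|R| = ((p ^ m) ^ 2)%N.
  by rewrite (card_chain_ring gamma_max) // card_gammaR.
have Kp : p \in [pchar K].
  (* p is nilpotent in R, because |R| is a power of p. *)
  rewrite inE p_prime; have /(congr1 pi) := card_natr_eq0 R.
  rewrite rmorph0 rmorph_nat card_R !natrX => /eqP.
  by rewrite !expf_eq0 => /andP[_ /andP[_]].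
have P_gt0 : (0 < p ^ s)%N by rewrite expn_gt0 prime_gt0.
have alpha0_neq0 : pi alpha0 != 0.
  have alpha0_nz : alpha0 != 0.
    apply/eqP=> E; apply: alpha_neq0; rewrite alphaE E expr0n.
    by rewrite eqn0Ngt P_gt0.
  (* alpha0 is now a power of zeta, whose reduction is still a root of unity. *)
  move: alpha0_T; rewrite inE in_set1 (negPf alpha0_nz) => /imsetP[i _ ->].
  have q1_gt0 := prim_order_gt0 zeta_order.
  rewrite rmorphXn expf_neq0 //; apply/eqP=> zeta0.
  have /(congr1 pi)/eqP := prim_expr_order zeta_order.
  by rewrite rmorphXn rmorph1 /= zeta0 expr0n eqn0Ngt q1_gt0 eq_sym oner_eq0.
have n_neq0 : n%:R != 0 :> K.
  by rewrite -(dvdn_pcharf Kp) -prime_coprime // coprime_sym.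
have f_red : map_poly pi (xn_sub n alpha0) = 'X^n - (pi alpha0)%:P.
  by rewrite /xn_sub rmorphB /= map_polyXn map_polyC.
have h_red : map_poly pi h = map_poly pi (xn_sub n alpha0) ^+ (p ^ s).
  rewrite f_red XnsubC_exp_pchar // rmorphB /= map_polyXn map_polyC.
  by rewrite alphaE -(rmorphXn pi).
have irr_f : irreducible_poly (map_poly pi (xn_sub n alpha0)).
  apply: (irreducible_red pi_surj pi_kerE pi_ann gamma_sq irr).
    by rewrite f_red; apply: separable_XnsubC.
  by rewrite f_red size_XnsubC.
have N_gt0 : (0 < n * p ^ s)%N by rewrite muln_gt0 n_gt0.
have h_monic : h \is monic by rewrite monicXnsubC.
have size_h : size h = (n * p ^ s).+1 by rewrite size_XnsubC.
have f_monic : xn_sub n alpha0 \is monic by rewrite monicXnsubC.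
have size_f : size (xn_sub n alpha0) = n.+1 by rewrite size_XnsubC.
have count w k (rt : residue_torsion pi gamma (xn_sub n alpha0) (p ^ s) C w k) :=
  num_weight_residue_torsion pi_kerE gamma_sq h_monic size_h f_monic size_f
    N_gt0 C_ideal rt card_gammaR card_R.
have gfE j : g * f ^+ j = in_qpoly h (gamma *: xn_sub n alpha0 ^+ j).
  by rewrite -mul_polyC in_qpolyM rmorphXn.
have mainE w t G : main_gen f g w t G =
    in_qpoly h (xn_sub n alpha0 ^+ w +
      gamma *: (xn_sub n alpha0 ^+ t * polyn G)).
  rewrite /main_gen gfE rmorphD rmorphXn /= scalerAl in_qpolyM.
  by rewrite [in_qpoly h (polyn G)]in_qpolyK.
have pm2 : (p ^ (2 * m) = (p ^ m) ^ 2)%N by rewrite -expnM mulnC.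
split; [|split; [|split; [|split]]].
- move=> C0 r le_r; rewrite (count (p ^ s)%N (p ^ s)%N) //; last first.
    by rewrite C0; exact: (residue_torsion0 pi_kerE pi_ann gamma_sq h_monic
      size_h N_gt0 h_red).
  by rewrite le_r.
- move=> C1 r le_r; rewrite (count 0%N 0%N) //; last first.
    by rewrite C1; exact: residue_torsion1.
  case: r le_r => [//|r] _; rewrite muln0 /= !subn0 pm2 -!expnM.
  by rewrite (mulnS 2) addKn (subn1 r.+1) mulnA [(m * 2)%N]mulnC.
- move=> tau [lt_tau CE] r le_r; rewrite (count (p ^ s)%N tau) //; last first.
    by rewrite CE gfE; apply: (residue_torsion_gamma pi_kerE pi_ann gamma_sq
      h_monic size_h N_gt0 h_red); exact: ltnW.
  by rewrite le_r expnM.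
- move=> w t G k [/andP[_ lt_w] [k_in k_min] _ _ CE] r le_r.
  rewrite (count w k) //; last first.
    rewrite CE mainE; apply: (residue_torsion_main pi_surj pi_kerE pi_ann
      gamma_sq h_monic size_h N_gt0 h_red irr_f lt_w).
      by rewrite -gfE -mainE.
    by move=> j; rewrite -gfE -mainE; apply: k_min.
  by rewrite pm2 !expnM.
- move=> w t G k mu [/andP[/andP[lt_mu _] lt_w] [k_in k_min] _ _ CE] r le_r.
  rewrite (count w mu) //; last first.
    rewrite CE mainE gfE; apply: (residue_torsion_main2 pi_surj pi_kerE pi_ann
      gamma_sq h_monic size_h N_gt0 h_red irr_f lt_w _ (ltnW lt_mu)).
    by move=> j; rewrite -gfE -mainE; apply: k_min.
  by rewrite pm2 !expnM.
Qed.
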